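(* Let $\nu$ be a generalized semiclassical weight on $\mathbb T$, with associated finite set $\mathcal Z_A$. Then for every $n\in\mathbb N$ the matrix function $Y_n$ satisfies, on $\mathbb C\setminus(\mathbb T\cup\mathcal Z_A)$, $$Y_n''+2Y_n'\,C_n'C_n^{-1}+Y_n\,C_n''C_n^{-1}=\big(M_n'+M_n^2\big)\,Y_n .$$
   Context: $\mathbb N=\{1,2,\dots\}$, $\mathbb T=\{|z|=1\}$ (counterclockwise). $\nu$ is a positive integrable weight on $\mathbb T$ and $d\mu(z)=\frac{\nu(z)}{\mathrm i z}dz$. $\Phi_n$ is the monic polynomial of degree $n$ with $\int_{\mathbb T}\Phi_n\overline{\Phi_m}\,d\mu=\kappa_n^{-2}\delta_{n,m}$, $\kappa_n>0$; $\Phi_n^*(z)=z^n\overline{\Phi_n(1/\bar z)}$; $b_n=2\pi\kappa_n^2$. For $z\notin\mathbb T$, $$G_n(z)=\frac1{2\pi \mathrm i}\int_{\mathbb T}\frac{\Phi_n(t)}{t-z}\frac{\nu(t)}{t^n}dt,\quad G_{n-1}^*(z)=\frac1{2\pi \mathrm i}\int_{\mathbb T}\frac{\Phi_{n-1}^*(t)}{t-z}\frac{\nu(t)}{t^n}dt,\quad Y_n=\begin{bmatrix}\Phi_n&G_n\\-b_{n-1}\Phi_{n-1}^*&-b_{n-1}G_{n-1}^*\end{bmatrix}\quad(n\in\mathbb N).$$ Generalized semiclassical weight: $\nu$ satisfies $zA(z)\nu'(z)=q(z)\nu(z)$ off the set $\mathcal Z_A$ of zeros of $zA(z)$, where $A$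 is a (nonzero) polynomial and $q$ is entire. Off $\mathcal Z_A$, $\nu$ denotes the (possibly multivalued, nonvanishing) analytic function determined by this equation and the weight on $\mathbb T\setminus \mathcal Z_A$. $C_n(z)=\operatorname{diag}\big(z^{-n/2}\nu(z)^{1/2},\,z^{n/2}\nu(z)^{-1/2}\big)$, $Z_n=Y_nC_n$, $M_n=Z_n'Z_n^{-1}$ (structure matrix). Local analytic branches are used for the powers; $C_n'C_n^{-1}=\big(-\frac n{2z}+\frac{q(z)}{2zA(z)}\big)\operatorname{diag}(1,-1)$, $C_n''C_n^{-1}$ and $M_n$ do not depend on the branches and are single valued. *)

(* Defs.v *)
From HB Require Import structures.
From mathcomp Require Import all_boot all_order all_algebra.
From mathcomp Require Import all_classical all_reals all_analysis.
From mathcomp Require Import complex.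

Set Implicit Arguments.
Unset Strict Implicit.
Unset Printing Implicit Defensive.

Import Order.TTheory GRing.Theory Num.Theory numFieldNormedType.Exports.

Local Open Scope ring_scope.
Local Open Scope classical_set_scope.

(* R[i] bundled as a numClosedFieldType: under this key it carries both the
   field operations, conjugation and 'i, and the topology and normed space
   structure of MathComp-Analysis over itself, so that derivable f z 1 and
   derive1 f z are complex differentiability and the complex derivative. *)
Definition cplx (R : realType) : numClosedFieldType := R[i].

Section Circle.
Context {R : realType}.
Local Notation C := (cplx R).

Definition ofR (x : R) : C := (x%:C)%C.

Definition expi (theta : R) : C := Complex (cos theta) (sin theta).

Definition unit_circle : set C := [set z : C | `|z| = 1].

(* Lebesgue integral of g over [0, 2 pi], by real and imaginary parts. *)
Definition integral_angle (g : R -> C) : C :=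
  Complex (\int[lebesgue_measure]_(theta in `[0, 2 * pi]) complex.Re (g theta))
          (\int[lebesgue_measure]_(theta in `[0, 2 * pi]) complex.Im (g theta)).

(* Counterclockwise integral of f(t) dt over the unit circle, t = expi theta
   and dt = i t dtheta. *)
Definition circle_integral (f : C -> C) : C :=
  integral_angle (fun theta => f (expi theta) * ('i * expi theta)).

End Circle.

Section OPUC.
Context {R : realType}.
Local Notation C := (cplx R).
Implicit Types (nu : C -> R) (Phi : nat -> {poly C}) (kappa : nat -> R).

(* Only the values of nu on the unit circle matter. Positivity is required
   almost everywhere, because a semiclassical weight may vanish or blow up at
   the zeros of A lying on the circle. *)
Definition positive_integrable_weight nu : Prop :=
  lebesgue_measure.-integrable `[0, 2 * pi]
    (fun theta : R => (nu (expi theta))%:E) /\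
  {ae lebesgue_measure, forall theta : R,
    `[0, 2 * pi]%classic theta -> 0 < nu (expi theta)}.

(* Integral of f against dmu(t) = nu(t) / (i t) dt. *)
Definition integral_mu nu (f : C -> C) : C :=
  circle_integral (fun t => f t * (ofR (nu t) / ('i * t))).

Definition is_opuc nu Phi kappa : Prop :=
  [/\ forall n, Phi n \is monic,
      forall n, size (Phi n) = n.+1,
      forall n, 0 < kappa n &
      forall n m, integral_mu nu (fun t => (Phi n).[t] * ((Phi m).[t])^*) =
        if n == m then ofR (kappa n ^- 2) else 0].

(* Phi_n^*, to be used at z != 0 only: z^-1 is 0 at z = 0. *)
Definition reversed Phi n (z : C) : C := z ^+ n * ((Phi n).[(z^*)^-1])^*.

Definition second_kind nu Phi n (z : C) : C :=
  (2 * ofR pi * 'i)^-1 *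
  circle_integral (fun t => (Phi n).[t] / (t - z) * (ofR (nu t) / t ^+ n)).

(* second_kind_rev nu Phi n is G_{n-1}^*, for 0 < n. *)
Definition second_kind_rev nu Phi n (z : C) : C :=
  (2 * ofR pi * 'i)^-1 *
  circle_integral
    (fun t => reversed Phi n.-1 t / (t - z) * (ofR (nu t) / t ^+ n)).

Definition b_coef kappa n : C := ofR (2 * pi * kappa n ^+ 2).

Definition mx22 (a b c d : C) : 'M[C]_2 :=
  \matrix_(i, j) if i == 0 then (if j == 0 then a else b)
                 else (if j == 0 then c else d).

Definition Ymx nu Phi kappa n (z : C) : 'M[C]_2 :=
  mx22 (Phi n).[z] (second_kind nu Phi n z)
       (- b_coef kappa n.-1 * reversed Phi n.-1 z)
       (- b_coef kappa n.-1 * second_kind_rev nu Phi n z).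

End OPUC.

Section Semiclassical.
Context {R : realType}.
Local Notation C := (cplx R).
Implicit Types (nu : C -> R) (A : {poly C}) (q w : C -> C) (c e : C).

Definition entire (f : C -> C) : Prop := forall z : C, derivable f z 1.

Definition zeros_zA A : set C := [set z : C | root ('X * A) z].

(* A function element: w is a nonvanishing holomorphic solution of
   z A(z) w'(z) = q(z) w(z) on the disk ball c e, which avoids the zeros of
   zA(z). *)
Definition function_element A q c e w : Prop :=
  [/\ 0 < e,
      ball c e `&` zeros_zA A = set0 &
      forall z : C, ball c e z ->
        [/\ derivable w z 1, w z != 0 & z * A.[z] * derive1 w z = q z * w z]].

Definition extends_weight nu c e w : Prop :=
  forall t : C, ball c e t -> unit_circle t -> w t = ofR (nu t).

Definition generalized_semiclassical nu A q : Prop :=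
  [/\ A != 0, entire q &
      forall t : C, unit_circle t -> ~ zeros_zA A t ->
        exists e w, function_element A q t e w /\ extends_weight nu t e w].

(* The multivalued analytic function nu off the zeros of zA(z), as the
   collection of its elements: those obtained from the weight on the circle
   by analytic continuation along chains of overlapping disks. *)
Inductive weight_element nu A q : C -> C -> (C -> C) -> Prop :=
| weight_element_circle t e w :
    unit_circle t ->
    function_element A q t e w -> extends_weight nu t e w ->
    weight_element nu A q t e w
| weight_element_continuation c e w c' e' w' :
    weight_element nu A q c e w ->
    function_element A q c' e' w' ->
    ball c e `&` ball c' e' !=set0 ->
    {in ball c e `&` ball c' e', w =1 w'} ->
    weight_element nu A q c' e' w'.

Definition sqrt_branch c e w (s : C -> C) : Prop :=
  forall z : C, ball c e z -> derivable s z 1 /\ s z ^+ 2 = w z.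

(* D is a local branch around z0 of
   C_n(z) = diag (z^(-n/2) nu(z)^(1/2), z^(n/2) nu(z)^(-1/2)), built on an
   element w of nu and on branches r of z^(1/2) and s of w^(1/2). *)
Definition C_branch nu A q n (z0 : C) (D : C -> 'M[C]_2) : Prop :=
  exists c e w r s,
    [/\ weight_element nu A q c e w, ball c e z0,
        sqrt_branch c e id r, sqrt_branch c e w s &
        forall z : C, ball c e z ->
          D z = mx22 (r z ^- n * s z) 0 0 (r z ^+ n * (s z)^-1)].

End Semiclassical.

Section StructureMatrix.
Context {R : realType}.
Local Notation C := (cplx R).
Implicit Types (Y D : C -> 'M[C]_2).

(* Z' Z^-1 for Z = Y D. *)
Definition structure_mx Y D (z : C) : 'M[C]_2 :=
  let Z := fun u : C => Y u *m D u in derive1 Z z *m invmx (Z z).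

End StructureMatrix.

(* Main.v *)
Require Import Defs.
From mathcomp Require Import all_boot all_order all_algebra.
From mathcomp Require Import all_classical all_reals all_analysis.
From mathcomp Require Import complex perm measurable_realfun ring zify.
Import Order.TTheory GRing.Theory Num.Theory numFieldNormedType.Exports.
Local Open Scope ring_scope.
Local Open Scope classical_set_scope.

(* Since C_n is locally an analytic matrix function, the identity is the
   derivative of Z_n' = M_n Z_n multiplied on the right by C_n^-1, once Y_n is
   known to be invertible. If a row vector kills Y_n(z), then a combination P of
   Phi_n and Phi_{n-1}^* vanishes at z together with its Cauchy transform.
   Writing P = (t - z) r, the latter says that r is orthogonal to t^(n-1);
   since P is orthogonal to t, ..., t^(n-1), so is r to t^(n-2), ..., 1.
   As r has degree less than n, r = 0, hence P = 0 and the row vector is 0. *)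

Set Implicit Arguments.
Unset Strict Implicit.
Unset Printing Implicit Defensive.

(** * Twice derivable functions and matrices *)

(** The identity involves two derivatives, while a branch of a square root is only assumed to be
    derivable once. Second derivability is therefore always earned from an explicit formula for the
    first derivative. For the entries of [C_n] this formula comes from a logarithmic derivative, and
    here the semiclassical equation and the entireness of [q] enter. For the Cauchy transforms it is
    an integral with kernel (t - u)^(-2), reached through a quadratic remainder bound that is
    uniform on the circle. Invertibility of [Y_n] is obtained at each point separately from
    orthogonality, with no jump relation across the circle and no behaviour at infinity. The
    polynomial Phi_n is orthogonal to 1, ..., t^(n-1), but the reversed polynomial of index n - 1
    only to t, ..., t^(n-1). The factor t^(-n) in the Cauchy transform supplies exactly the one
    relation that starts the descent. *)

Section MatrixDerivative.
Context {K : numFieldType}.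

Lemma derivable_entry m n (F : K -> 'M[K]_(m, n)) z i j :
  derivable F z 1 -> derivable (fun u => F u i j) z 1.
Proof.
move=> /derivable1_diffP dF; apply/derivable1_diffP.
exact: (differentiable_comp dF (differentiable_coord (F z) i j)).
Qed.

Lemma derive1_entry m n (F : K -> 'M[K]_(m, n)) z i j :
  derivable F z 1 -> derive1 (fun u => F u i j) z = derive1 F z i j.
Proof.
move=> dF; rewrite !derive1E; apply: cvg_lim => //.
rewrite (_ : (fun h => _) = (fun M : 'M[K]_(m, n) => M i j) \o
    (fun h => h^-1 *: ((F \o shift z) (h *: 1) - F z))); last first.
  by apply/funext => h /=; rewrite !mxE.
apply: continuous_cvg; last exact: dF.
exact: coord_continuous.
Qed.

(** Expanding [F] over the elementary matrices leaves scalar functions times constant matrices. *)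
Lemma derivable_matrix m n (F : K -> 'M[K]_(m, n)) z :
  (forall i j, derivable (fun u => F u i j) z 1) -> derivable F z 1.
Proof.
move=> dF; rewrite (_ : F = \sum_(ij : 'I_m * 'I_n)
    fun u => F u ij.1 ij.2 *: delta_mx ij.1 ij.2); last first.
  apply/funext => u; rewrite fct_sumE -(pair_bigA _ (fun i j =>
    F u i j *: delta_mx i j)) /=; exact: matrix_sum_delta.
elim/big_ind : _ => [|f g|[i j] _].
- exact: derivable_cst.
- exact: derivableD.
- by apply/derivable1_diffP/differentiableZl/derivable1_diffP/dF.
Qed.

Lemma derivable_mulmx m n p (F : K -> 'M[K]_(m, n)) (G : K -> 'M[K]_(n, p)) z :
  derivable F z 1 -> derivable G z 1 -> derivable (fun u => F u *m G u) z 1.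
Proof.
move=> dF dG; apply: derivable_matrix => i j.
rewrite (_ : (fun _ => _) = \sum_k ((fun u => F u i k) * (fun u => G u k j))).
  by apply: derivable_sum => k; apply: derivableM; exact: derivable_entry.
by apply/funext => u; rewrite fct_sumE mxE.
Qed.

Lemma derive1_mulmx m n p (F : K -> 'M[K]_(m, n)) (G : K -> 'M[K]_(n, p)) z :
  derivable F z 1 -> derivable G z 1 ->
  derive1 (fun u => F u *m G u) z = derive1 F z *m G z + F z *m derive1 G z.
Proof.
move=> dF dG; apply/matrixP => i j.
rewrite -derive1_entry; last exact: derivable_mulmx.
rewrite (_ : (fun _ => _) = \sum_k ((fun u => F u i k) * (fun u => G u k j))).
  rewrite derive1E derive_sum => [|k]; last first.
    by apply: derivableM; exact: derivable_entry.
  rewrite !mxE -big_split; apply: eq_bigr => k _ /=.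
  rewrite deriveM; try exact: derivable_entry.
  rewrite -!derive1E !derive1_entry// addrC /GRing.scale/=.
  by congr (_ + _); rewrite mulrC.
by apply/funext => u; rewrite fct_sumE mxE.
Qed.

(** Functions equal near [z] are equal near every point close to [z], which is what comparing
    derivatives there requires. *)
Lemma near_derive1_eq (V : normedModType K) (f g : K -> V) (z : K) :
  {near z, f =1 g} -> {near z, derive1 f =1 derive1 g}.
Proof.
move=> /near_join; apply: filterS => u fg.
by rewrite !derive1E; exact: near_eq_derive.
Qed.

(** Since [derive1] is total, derivability is demanded on a whole neighbourhood: otherwise
    [derive1 f] could be a meaningless limit at points near [z]. *)
Definition derivable2 (V : normedModType K) (f : K -> V) z :=
  (\forall u \near z, derivable f u 1) /\ derivable (derive1 f) z 1.

Lemma derivable2_near_eq (V : normedModType K) (f g : K -> V) z :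
  {near z, f =1 g} -> derivable2 f z -> derivable2 g z.
Proof.
move=> fg [f1 f2]; split; last first.
  by apply: near_eq_derivable f2; exact: near_derive1_eq.
move: f1; apply: filter_app; move/near_join : fg; apply: filterS => u.
exact: near_eq_derivable.
Qed.

Section Scalar.
Implicit Types (f g : K -> K) (z : K).

(** The working criterion: a formula valid near [z] takes the place of the abstract [derive1 f]. *)
Lemma derivable2_of_derive1 f f' z :
  (\forall u \near z, derivable f u 1 /\ derive1 f u = f' u) ->
  derivable f' z 1 -> derivable2 f z.
Proof.
move=> ff' df'; split; first by apply: filterS ff' => u [].
by apply: near_eq_derivable df'; apply: filterS ff' => u [].
Qed.

Lemma derivable2_derivable f z : derivable2 f z -> derivable f z 1.
Proof. by case=> /nbhs_singleton. Qed.

Lemma derivable2_cst (a z : K) : derivable2 (fun=> a) z.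
Proof.
apply: (@derivable2_of_derive1 _ (fun=> 0)); last exact: derivable_cst.
by near=> u; split; [exact: derivable_cst|rewrite derive1_cst].
Unshelve. all: by end_near. Qed.

Lemma derivable2_id z : derivable2 id z.
Proof.
apply: (@derivable2_of_derive1 _ (fun=> 1)); last exact: derivable_cst.
by near=> u; split; [exact: derivable_id|rewrite derive1E derive_id].
Unshelve. all: by end_near. Qed.

Lemma derivable2D f g z :
  derivable2 f z -> derivable2 g z -> derivable2 (fun u => f u + g u) z.
Proof.
move=> [f1 f2] [g1 g2].
apply: (@derivable2_of_derive1 _ (derive1 f + derive1 g)); last first.
  exact: derivableD.
by apply: filterS2 f1 g1 => u fu gu; split;
  [exact: derivableD|rewrite !derive1E deriveD// -!derive1E].
Qed.

Lemma derivable2M f g z :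
  derivable2 f z -> derivable2 g z -> derivable2 (fun u => f u * g u) z.
Proof.
move=> f12 g12; have [f1 f2] := f12; have [g1 g2] := g12.
apply: (@derivable2_of_derive1 _ (f * derive1 g + g * derive1 f)); last first.
  have fz := derivable2_derivable f12; have gz := derivable2_derivable g12.
  exact: derivableD (derivableM fz g2) (derivableM gz f2).
by apply: filterS2 f1 g1 => u fu gu; split;
  [exact: derivableM|rewrite !derive1E deriveM// -!derive1E].
Qed.

Lemma derivable_neq0 f z : derivable f z 1 -> f z != 0 ->
  \forall u \near z, f u != 0.
Proof.
move=> /derivable1_diffP/differentiable_continuous fz fz0.
exact: (@cvgr_neq0 K K K _ _ f (f z) fz fz0).
Qed.

Lemma derivable2V f z :
  derivable2 f z -> f z != 0 -> derivable2 (fun u => (f u)^-1) z.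
Proof.
move=> f12 fz0; have [f1 f2] := f12; have fz := derivable2_derivable f12.
apply: (@derivable2_of_derive1 _ (fun u => - (f u * f u)^-1 * derive1 f u)).
  apply: filterS2 f1 (derivable_neq0 fz fz0) => u fu fu0.
  by split; [exact: derivableV|rewrite derive1E deriveV// -derive1E].
apply: derivableM f2; apply: derivableN.
by apply: derivableV; [rewrite mulf_neq0|exact: derivableM].
Qed.

Lemma derivable2X f n z : derivable2 f z -> derivable2 (fun u => f u ^+ n) z.
Proof.
move=> fz; elim: n => [|n IHn].
  by under eq_fun do rewrite expr0; exact: derivable2_cst.
by under eq_fun do rewrite exprS; exact: derivable2M.
Qed.

Lemma derivable2_horner (p : {poly K}) z : derivable2 (horner p) z.
Proof.
elim/poly_ind : p => [|p c IHp].
  rewrite (_ : horner 0 = fun=> 0); first exact: derivable2_cst.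
  by apply/funext => u; rewrite horner0.
rewrite (_ : horner _ = fun u => p.[u] * u + c); last first.
  by apply/funext => u; rewrite !hornerE.
apply: derivable2D (derivable2_cst _ _).
exact: derivable2M (derivable2_id _).
Qed.

(* A square root of a function with a derivable logarithmic derivative [g] has
   logarithmic derivative [g / 2]. *)
Lemma derivable2_sqrt (s w : K -> K) g z :
  (\forall u \near z, derivable s u 1 /\ s u ^+ 2 = w u) ->
  (\forall u \near z, w u != 0 /\ derive1 w u = g u * w u) ->
  derivable g z 1 -> derivable2 s z.
Proof.
move=> sw wg dg; have [sz _] := nbhs_singleton sw.
apply: (@derivable2_of_derive1 _ (fun u => 2^-1 * (g u * s u))); last first.
  by apply: derivableM; [exact: derivable_cst|exact: derivableM].
move/near_join : (sw) => sww.
apply: filterS2 sww wg => u sww_u [wu0 wug].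
have [su suw] := nbhs_singleton sww_u.
have su0 : s u != 0 by move: wu0; rewrite -suw expf_eq0.
(* Differentiating s^2 = w gives 2 s s' = g s^2, from which 2 s is cancelled. *)
split => //; have : derive1 w u = derive1 (s * s) u.
  rewrite !derive1E; apply: near_eq_derive.
  by apply: filterS sww_u => v [_ <-]; rewrite expr2.
rewrite wug [RHS]derive1E deriveM// -derive1E -suw /GRing.scale/= -mulr2n.
rewrite expr2 => e; apply: (mulfI su0).
have s2 : 2 != 0 :> K by rewrite pnatr_eq0.
by apply: (mulfI s2); rewrite mulr_natl -e; field.
Qed.

End Scalar.

Section Matrix2.
Variables (m n : nat).
Implicit Types F : K -> 'M[K]_(m, n).

Lemma derivable2_matrix F z :
  (forall i j, derivable2 (fun u => F u i j) z) -> derivable2 F z.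
Proof.
move=> dF; have F1 : \forall u \near z, derivable F u 1.
  have : \forall u \near z, forall ij : 'I_m * 'I_n,
      derivable (fun v => F v ij.1 ij.2) u 1.
    near=> u; near: u; apply: filter_forall => ij.
    exact: (dF ij.1 ij.2).1.
  apply: filterS => u Fu; apply: derivable_matrix => i j; exact: (Fu (i, j)).
split=> //; apply: derivable_matrix => i j.
apply: near_eq_derivable (dF i j).2.
by apply: filterS F1 => u; exact: derive1_entry.
Unshelve. all: by end_near. Qed.

Lemma derivable2_entry F z i j :
  derivable2 F z -> derivable2 (fun u => F u i j) z.
Proof.
case=> F1 F2; split.
  by apply: filterS F1 => u; exact: derivable_entry.
apply: near_eq_derivable; last exact: derivable_entry i j F2.
by apply: filterS F1 => u Fu; rewrite derive1_entry.
Qed.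

End Matrix2.

Lemma derivable2_mulmx m n p (F : K -> 'M[K]_(m, n)) (G : K -> 'M[K]_(n, p)) z :
  derivable2 F z -> derivable2 G z -> derivable2 (fun u => F u *m G u) z.
Proof.
move=> dF dG; apply: derivable2_matrix => i j.
rewrite (_ : (fun _ => _) = \sum_k (fun u => F u i k * G u k j)); last first.
  by apply/funext => u; rewrite fct_sumE mxE.
elim/big_ind : _ => [|f g|k _]; [exact: derivable2_cst|exact: derivable2D|].
by apply: derivable2M; exact: derivable2_entry.
Qed.

Lemma derivable_det n (F : K -> 'M[K]_n) z :
  derivable F z 1 -> derivable (fun u => \det (F u)) z 1.
Proof.
move=> dF; rewrite /determinant.
rewrite (_ : (fun _ => _) = \sum_(s : 'S_n) ((fun=> (-1) ^+ s) *
    \prod_i fun u => F u i (s i))); last first.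
  apply/funext => u; rewrite fct_sumE; apply: eq_bigr => s _ /=.
  by rewrite fct_prodE.
elim/big_ind : _ => [|f g|s _]; [exact: derivable_cst|exact: derivableD|].
apply: derivableM; first exact: derivable_cst.
elim/big_ind : _ => [|f g|i _]; [exact: derivable_cst|exact: derivableM|].
exact: derivable_entry.
Qed.

(** [invmx] is defined by cases on invertibility. The determinant stays nonzero near [z], so the
    adjugate formula holds there and only determinants have to be differentiated. *)
Lemma derivable_invmx n (F : K -> 'M[K]_n) z :
  derivable F z 1 -> F z \in unitmx -> derivable (fun u => invmx (F u)) z 1.
Proof.
move=> dF; rewrite unitmxE unitfE => Fz.
apply: (@near_eq_derivable _ _ _ (fun u => (\det (F u))^-1 *: \adj (F u))).
  apply: filterS (derivable_neq0 (derivable_det dF) Fz) => u Fu.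
  by rewrite /invmx unitmxE unitfE Fu.
apply: derivable_matrix => i j; under eq_fun do rewrite !mxE.
apply: derivableM; first by apply: derivableV => //; exact: derivable_det.
rewrite /cofactor; apply: derivableM; first exact: derivable_cst.
apply: derivable_det; apply: derivable_matrix => k l.
by under eq_fun do rewrite !mxE; exact: derivable_entry.
Qed.

Lemma near_unitmx n (F : K -> 'M[K]_n) z :
  derivable F z 1 -> F z \in unitmx -> \forall u \near z, F u \in unitmx.
Proof.
move=> dF; rewrite unitmxE unitfE => /(derivable_neq0 (derivable_det dF)).
by apply: filterS => u; rewrite unitmxE unitfE.
Qed.

(* Differentiate [Z' = M Z]. *)
Lemma derive1_log_derivative n (Z : K -> 'M[K]_n) z :
  derivable2 Z z -> Z z \in unitmx ->
  let M := fun u => derive1 Z u *m invmx (Z u) in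
  derive1 (derive1 Z) z = (derive1 M z + M z *m M z) *m Z z.
Proof.
move=> [dZ ddZ] Zz M; have dZz : derivable Z z 1 by exact: nbhs_singleton dZ.
have dM : derivable M z 1.
  exact: (derivable_mulmx ddZ (derivable_invmx dZz Zz)).
(* The equation is about to be differentiated, so it is needed near [z] and not just at [z]. *)
have ZM : {near z, derive1 Z =1 fun u => M u *m Z u}.
  by apply: filterS (near_unitmx dZz Zz) => u Zu; rewrite /M mulmxKV.
rewrite (nbhs_singleton (near_derive1_eq ZM)) derive1_mulmx//.
by rewrite mulmxDl -mulmxA -(nbhs_singleton ZM).
Qed.

Lemma derive12_mulmx m n p (F : K -> 'M[K]_(m, n)) (G : K -> 'M[K]_(n, p)) z :
  derivable2 F z -> derivable2 G z ->
  derive1 (derive1 (fun u => F u *m G u)) z =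
  derive1 (derive1 F) z *m G z + 2 *: (derive1 F z *m derive1 G z) +
  F z *m derive1 (derive1 G) z.
Proof.
move=> [F1 F2] [G1 G2].
have Fz : derivable F z 1 by exact: nbhs_singleton F1.
have Gz : derivable G z 1 by exact: nbhs_singleton G1.
have FG : {near z, derive1 (fun u => F u *m G u) =1
    (fun u => derive1 F u *m G u) + (fun u => F u *m derive1 G u)}.
  by apply: filterS2 F1 G1 => u Fu Gu; rewrite (derive1_mulmx Fu Gu).
rewrite (nbhs_singleton (near_derive1_eq FG)).
have FG1 := derivable_mulmx F2 Gz; have FG2 := derivable_mulmx Fz G2.
rewrite derive1E (deriveD FG1 FG2) -!derive1E.
rewrite (derive1_mulmx F2 Gz) (derive1_mulmx Fz G2) scaler_nat mulr2n.
by rewrite !addrA.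
Qed.

End MatrixDerivative.

(** * Integration against a weight on the circle *)

Section CircleContinuous.
Context {R : realType}.
Local Notation C := (cplx R).
Implicit Types (f g : C -> C) (nu : C -> R).

(** Continuity in the angle, by real and imaginary parts, matches the way the integrals are defined.
    It makes each part bounded on the segment of angles, hence integrable against the weight. *)
Definition circle_continuous f :=
  continuous (fun theta : R => complex.Re (f (expi theta))) /\
  continuous (fun theta : R => complex.Im (f (expi theta))).

Lemma ReD (x y : C) : complex.Re (x + y) = complex.Re x + complex.Re y.
Proof. by case: x y => [? ?] []. Qed.

Lemma ImD (x y : C) : complex.Im (x + y) = complex.Im x + complex.Im y.
Proof. by case: x y => [? ?] []. Qed.

Lemma ReM (x y : C) : complex.Re (x * y) =
  complex.Re x * complex.Re y - complex.Im x * complex.Im y.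
Proof. by case: x y => [? ?] []. Qed.

Lemma ImM (x y : C) : complex.Im (x * y) =
  complex.Re x * complex.Im y + complex.Im x * complex.Re y.
Proof. by case: x y => [? ?] []. Qed.

Lemma conjE (x : C) : x^* = Complex (complex.Re x) (- complex.Im x).
Proof. by case: x. Qed.

Lemma norm_Complex_le (x : C) :
  `|x| <= ofR (`|complex.Re x| + `|complex.Im x|).
Proof.
rewrite [x in leLHS]complexE; apply: (le_trans (ler_normD _ _)).
rewrite normrM normCi mul1r.
by rewrite !normc_def /= !expr0n/= !addr0 !sqrtr_sqr -rmorphD.
Qed.

Lemma norm_expi theta : `|expi theta : C| = 1.
Proof. by rewrite normc_def /= cos2Dsin2 sqrtr1. Qed.

Lemma expi_neq0 theta : expi theta != 0 :> C.
Proof. by rewrite -normr_eq0 norm_expi oner_eq0. Qed.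

Lemma circle_continuous_cst (a : C) : circle_continuous (fun=> a).
Proof. by split; move=> x; exact: cvg_cst. Qed.

Lemma circle_continuous_id : circle_continuous id.
Proof. by split; [exact: continuous_cos|exact: continuous_sin]. Qed.

Lemma circle_continuousD f g : circle_continuous f -> circle_continuous g ->
  circle_continuous (fun t => f t + g t).
Proof.
move=> [f1 f2] [g1 g2]; split=> x.
- by under eq_fun do rewrite ReD; apply: cvgD; [exact: f1|exact: g1].
- by under eq_fun do rewrite ImD; apply: cvgD; [exact: f2|exact: g2].
Qed.

Lemma circle_continuousM f g : circle_continuous f -> circle_continuous g ->
  circle_continuous (fun t => f t * g t).
Proof.
move=> [f1 f2] [g1 g2]; split=> x.
- by under eq_fun do rewrite ReM; apply: cvgB; apply: cvgM;
    [exact: f1|exact: g1|exact: f2|exact: g2].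
- by under eq_fun do rewrite ImM; apply: cvgD; apply: cvgM;
    [exact: f1|exact: g2|exact: f2|exact: g1].
Qed.

Lemma circle_continuous_conj f : circle_continuous f ->
  circle_continuous (fun t => (f t)^*).
Proof.
move=> [f1 f2]; split=> x.
- by under eq_fun do rewrite conjE /=; exact: f1.
- by under eq_fun do rewrite conjE /=; apply: cvgN; exact: f2.
Qed.

Lemma circle_continuousV f : circle_continuous f ->
  (forall theta, f (expi theta) != 0) -> circle_continuous (fun t => (f t)^-1).
Proof.
move=> [f1 f2] f0.
have n2 x : complex.Re (f (expi x)) ^+ 2 + complex.Im (f (expi x)) ^+ 2 != 0.
  apply: contra_neq (f0 x); case: (f (expi x)) => a b /= /eqP.
  rewrite paddr_eq0 ?sqr_ge0// !expf_eq0/= => /andP[/eqP-> /eqP->].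
  by [].
have cn2 x : (fun x =>
    complex.Re (f (expi x)) ^+ 2 + complex.Im (f (expi x)) ^+ 2) @ x -->
    complex.Re (f (expi x)) ^+ 2 + complex.Im (f (expi x)) ^+ 2.
  by apply: cvgD; rewrite expr2; apply: cvgM;
    [exact: f1|exact: f1|exact: f2|exact: f2].
have VE (a : C) : a^-1 =
    Complex (complex.Re a / (complex.Re a ^+ 2 + complex.Im a ^+ 2))
            (- (complex.Im a / (complex.Re a ^+ 2 + complex.Im a ^+ 2))).
  by case: a.
split=> x.
- under eq_fun do rewrite VE /=.
  by apply: cvgM; [exact: f1|apply: cvgV (n2 x) (cn2 x)].
- under eq_fun do rewrite VE /=.
  by apply: cvgN; apply: cvgM; [exact: f2|apply: cvgV (n2 x) (cn2 x)].
Qed.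

Lemma circle_continuousX f n : circle_continuous f ->
  circle_continuous (fun t => f t ^+ n).
Proof.
move=> cf; elim: n => [|n IHn].
  by under eq_fun do rewrite expr0; exact: circle_continuous_cst.
by under eq_fun do rewrite exprS; exact: circle_continuousM.
Qed.

Lemma circle_continuous_horner (p : {poly C}) : circle_continuous (horner p).
Proof.
elim/poly_ind : p => [|p c IHp].
  rewrite (_ : horner 0 = fun=> 0); first exact: circle_continuous_cst.
  by apply/funext => u; rewrite horner0.
rewrite (_ : horner _ = fun u => p.[u] * u + c); last first.
  by apply/funext => u; rewrite !hornerE.
apply: circle_continuousD (circle_continuous_cst _).
exact: circle_continuousM circle_continuous_id.
Qed.

End CircleContinuous.

Section IntegralMu.
Context {R : realType}.
Local Notation C := (cplx R).
Variable nu : C -> R.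
Hypothesis nu_weight : positive_integrable_weight nu.
Implicit Types (f g : C -> C).
Local Notation mu := (@lebesgue_measure R).
Local Notation I02pi := `[0, 2 * pi]%classic.

Lemma continuous_bounded_segment (h : R -> R) (a b : R) : continuous h ->
  exists2 M : R, 0 < M & forall x, `[a, b]%classic x -> `|h x| <= M.
Proof.
move=> ch; have : compact (h @` `[a, b]).
  apply: continuous_compact; last exact: segment_compact.
  exact: continuous_subspaceT.
move=> /compact_bounded[M [_ Mh]]; exists (`|M| + 1).
  by rewrite ltr_wpDl.
move=> x xab; apply: Mh; last by exists x.
by rewrite ltr_pwDr// ler_norm.
Qed.

Lemma integrable_weight (h : R -> R) : continuous h ->
  mu.-integrable I02pi (fun x => (h x * nu (expi x))%:E).
Proof.
move=> ch; rewrite (_ : (fun x => _) =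
    (EFin \o h) \* (fun x => (nu (expi x))%:E))%E; last by [].
apply: integrableMr => //.
- apply: measurable_funS (continuous_measurable_fun ch) => //.
- have [M M0 Mh] := continuous_bounded_segment 0 (2 * pi) ch.
  exists M; split; first exact: num_real.
  by move=> x Mx y /Mh/le_trans; apply; exact: ltW.
- by case: nu_weight.
Qed.

Lemma integrable_weightZ (a : R) (h : R -> R) : continuous h ->
  mu.-integrable I02pi (fun x => (a * (h x * nu (expi x)))%:E).
Proof. by move=> /integrable_weight ih; exact: (integrableZl _ a ih). Qed.

(** With t = e^(i theta), the factor i t of dt cancels the one in the density, so dmu is nu dtheta;
    as nu is real, the two parts separate. *)
Lemma integral_muE f : integral_mu nu f =
  Complex (\int[mu]_(x in I02pi) (complex.Re (f (expi x)) * nu (expi x)))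
          (\int[mu]_(x in I02pi) (complex.Im (f (expi x)) * nu (expi x))).
Proof.
rewrite /integral_mu /circle_integral /integral_angle.
have E (x : R) :
    f (expi x) * (ofR (nu (expi x)) / ('i * expi x)) * ('i * expi x) =
    f (expi x) * ofR (nu (expi x)) :> C.
  by rewrite -!mulrA mulVf ?mulr1// mulf_neq0 ?neq0Ci// expi_neq0.
congr Complex; apply: eq_Rintegral => x _; rewrite E.
  by rewrite ReM /= mulr0 subr0.
by rewrite ImM /= mulr0 add0r.
Qed.

Lemma eq_integral_mu f g : (forall t, `|t| = 1 -> f t = g t) ->
  integral_mu nu f = integral_mu nu g.
Proof.
move=> fg; rewrite !integral_muE.
by congr Complex; apply: eq_Rintegral => x _; rewrite fg// norm_expi.
Qed.

Lemma integral_muD f g : circle_continuous f -> circle_continuous g ->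
  integral_mu nu (fun t => f t + g t) = integral_mu nu f + integral_mu nu g.
Proof.
move=> [f1 f2] [g1 g2]; rewrite !integral_muE.
rewrite [RHS]/GRing.add/=; congr Complex; rewrite -RintegralD//.
- by apply: eq_Rintegral => x _; rewrite ReD mulrDl.
- exact: integrable_weight.
- exact: integrable_weight.
- by apply: eq_Rintegral => x _; rewrite ImD mulrDl.
- exact: integrable_weight.
- exact: integrable_weight.
Qed.

Lemma integral_muZ (a : C) f : circle_continuous f ->
  integral_mu nu (fun t => a * f t) = a * integral_mu nu f.
Proof.
case: a => a b [f1 f2]; rewrite !integral_muE.
rewrite [RHS]/GRing.mul/=; congr Complex;
  rewrite -!RintegralZl//; try exact: integrable_weight.
- rewrite -RintegralB//.
  + by apply: eq_Rintegral => x _; rewrite ReM /= mulrBl !mulrA.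
  + exact: integrable_weightZ.
  + exact: integrable_weightZ.
- rewrite -RintegralD//.
  + by apply: eq_Rintegral => x _; rewrite ImM /= mulrDl !mulrA.
  + exact: integrable_weightZ.
  + exact: integrable_weightZ.
Qed.

Lemma integral_mu_le : exists2 B : C, 0 <= B & forall f (M : C),
  circle_continuous f -> (forall x, I02pi x -> `|f (expi x)| <= M) ->
  `|integral_mu nu f| <= M * B.
Proof.
have iw : mu.-integrable I02pi (EFin \o (Num.norm \o (nu \o expi))).
  by apply: integrable_norm; exact: nu_weight.1.
pose B := \int[mu]_(x in I02pi) `|nu (expi x)|.
have B0 : 0 <= B by exact: Rintegral_ge0.
(* The real and imaginary parts are estimated separately, each contributing one [B]. *)
exists (ofR (B + B)); first by rewrite ler0c addr_ge0.
move=> f M [f1 f2] fM.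
(* The bound at angle 0 gives [0 <= M], which in the order of [C] also makes [M] real. *)
have M0 : 0 <= M.
  apply: le_trans (fM 0 _); rewrite ?normr_ge0//= in_itv/= lexx.
  by rewrite mulr_ge0// pi_ge0.
have MR : M = ofR (complex.Re M) by rewrite /ofR RRe_real// ger0_real.
have key (h : R -> R) : continuous h ->
    (forall x, I02pi x -> `|h x| <= complex.Re M) ->
    `|\int[mu]_(x in I02pi) (h x * nu (expi x))| <= complex.Re M * B.
  move=> ch hM.
  apply: le_trans (le_normr_Rintegral _ (integrable_weight ch)) _ => //.
  rewrite -RintegralZl//.
  apply: le_Rintegral => //.
  - exact: integrable_norm (integrable_weight ch).
  - exact: (integrableZl _ (complex.Re M) iw).
  - by move=> x xI; rewrite normrM ler_wpM2r// hM.
have Re_le (x : R) : I02pi x -> `|complex.Re (f (expi x))| <= complex.Re M.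
  move=> xI; rewrite -lecR -/(ofR _) -/(ofR (complex.Re M)) -MR.
  rewrite (le_trans _ (fM _ xI))//.
  rewrite normc_def lecR -sqrtr_sqr ler_wsqrtr// lerDl sqr_ge0//.
have Im_le (x : R) : I02pi x -> `|complex.Im (f (expi x))| <= complex.Re M.
  move=> xI; rewrite -lecR -/(ofR _) -/(ofR (complex.Re M)) -MR.
  rewrite (le_trans _ (fM _ xI))//.
  rewrite normc_def lecR -sqrtr_sqr ler_wsqrtr// lerDr sqr_ge0//.
rewrite integral_muE MR -rmorphM; apply: (le_trans (norm_Complex_le _)).
by rewrite lecR [leRHS]mulrDr; apply: lerD; exact: key.
Qed.

End IntegralMu.

(** * Cauchy transforms *)

(** After division by [h] the error is at most [B * |h|]. Such an explicit remainder survives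
    integration, so no limit theorem under the integral sign is called for. *)
Lemma derive1_of_quadratic_bound (K : numFieldType) (f : K -> K) (z l B d : K) :
  0 < d -> 0 <= B ->
  (forall h, `|h| < d -> `|f (h + z) - f z - h * l| <= B * `|h| ^+ 2) ->
  derivable f z 1 /\ derive1 f z = l.
Proof.
move=> d0 B0 fB.
have fl : h^-1 *: ((f \o shift z) (h *: 1) - f z) @[h --> 0^'] --> l.
  apply/cvgrPdist_le => e e0; near=> h.
  have h0 : h != 0 by near: h; exact: nbhs_dnbhs_neq.
  have hd : `|h| < d by near: h; exact: dnbhs0_lt.
  (* Adding 1 keeps the denominator positive when [B] is 0. *)
  have he : `|h| <= e / (B + 1).
    by near: h; apply: dnbhs0_le; rewrite divr_gt0// ltr_wpDl.
  rewrite /= [h *: 1]mulr1 distrC.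
  have -> : h^-1 *: (f (h + z) - f z) - l = h^-1 * (f (h + z) - f z - h * l).
    by rewrite /GRing.scale/=; field.
  rewrite normrM normfV ler_pdivrMl ?normr_gt0//.
  apply: (le_trans (fB h hd)); rewrite expr2 mulrCA ler_wpM2l//.
  apply: (le_trans (ler_wpM2l B0 he)).
  rewrite mulrA ler_pdivrMr ?ltr_wpDl// mulrC ler_wpM2l ?ltW//.
  by rewrite ltrDl.
split; first by apply/cvg_ex; exists l.
by rewrite derive1E; exact: cvg_lim.
Unshelve. all: by end_near. Qed.

Lemma near_norm_neq1 (K : numFieldType) (z : K) :
  `|z| != 1 -> \forall u \near z, `|u| != 1.
Proof.
rewrite -subr_eq0 => z1; have cz : (fun u : K => `|u| - 1) @ z --> `|z| - 1.
  apply: (@cvgB K K K (nbhs z) _ (fun u => `|u|) (fun=> 1));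
    last exact: cvg_cst.
  exact: (@norm_continuous K K).
have nz := @cvgr_neq0 K K K _ _ (fun u => `|u| - 1) _ cz z1.
by near=> u; rewrite -subr_eq0; near: u; exact: nz.
Unshelve. all: by end_near. Qed.

Section CauchyTransform.
Context {R : realType}.
Local Notation C := (cplx R).
Variable nu : C -> R.
Hypothesis nu_weight : positive_integrable_weight nu.
Implicit Types (g : C -> C).

(** The remainder bound on the kernel is uniform on the circle, so integrating it only multiplies
    [B] by the constant of [integral_mu_le]. *)
Lemma derive1_integral_mu (k : C -> C -> C) (k' : C -> C) (z B d : C) :
  0 < d -> 0 <= B ->
  (forall h, `|h| < d -> circle_continuous (k (h + z))) ->
  circle_continuous k' ->
  (forall h x, `|h| < d -> `[0, 2 * pi]%classic x ->
    `|k (h + z) (expi x) - k z (expi x) - h * k' (expi x)| <= B * `|h| ^+ 2) ->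
  let F := fun u => integral_mu nu (k u) in
  derivable F z 1 /\ derive1 F z = integral_mu nu k'.
Proof.
move=> d0 B0 ck ck' kB F.
have [N N0 nuN] := integral_mu_le nu_weight.
have ckz : circle_continuous (k z).
  by rewrite -[z]add0r; apply: ck; rewrite normr0.
apply: (@derive1_of_quadratic_bound _ F z (integral_mu nu k') (B * N) d d0).
  exact: mulr_ge0.
move=> h hd.
have cNk : circle_continuous (fun t => -1 * k z t).
  exact: circle_continuousM (circle_continuous_cst _) ckz.
have chk' : circle_continuous (fun t => (- h) * k' t).
  exact: circle_continuousM (circle_continuous_cst _) ck'.
have cD : circle_continuous (fun t => k (h + z) t + (-1) * k z t).
  by apply: circle_continuousD => //; exact: ck.
have -> : F (h + z) - F z - h * integral_mu nu k' =
    integral_mu nu (fun t => k (h + z) t + (-1) * k z t + (- h) * k' t).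
  rewrite !(integral_muD nu_weight)//; last exact: ck.
  by rewrite !(integral_muZ nu_weight)// mulN1r mulNr.
rewrite mulrAC; apply: nuN; first exact: circle_continuousD.
by move=> x xI; rewrite mulN1r mulNr; exact: kB.
Qed.

Lemma circle_continuous_bounded g (a b : R) : circle_continuous g ->
  exists2 M : C, 0 <= M & forall x, `[a, b]%classic x -> `|g (expi x)| <= M.
Proof.
move=> [g1 g2].
have [M1 M10 gM1] := continuous_bounded_segment a b g1.
have [M2 M20 gM2] := continuous_bounded_segment a b g2.
exists (ofR (M1 + M2)); first by rewrite ler0c addr_ge0// ltW.
move=> x xab; apply: (le_trans (norm_Complex_le _)).
by rewrite lecR lerD// ?gM1// gM2.
Qed.

Lemma circle_continuous_cauchy g u (k : nat) :
  circle_continuous g -> `|u| != 1 ->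
  circle_continuous (fun t => g t / (t - u) ^+ k).
Proof.
move=> cg u1; apply: circle_continuousM => //; apply: circle_continuousV.
  apply: circle_continuousX; apply: circle_continuousD circle_continuous_id _.
  exact: circle_continuous_cst.
move=> x; rewrite expf_neq0// subr_eq0; apply: contra_neq u1 => <-.
exact: norm_expi.
Qed.

(* Remainders of the first-order expansions of [a = (t - z - h)^-1] and of
   [a ^+ 2], where [b = (t - z)^-1]. *)
Lemma inv_sub_expansion (t z h : C) (a := (t - (h + z))^-1) (b := (t - z)^-1) :
  t - z != 0 -> t - (h + z) != 0 ->
  a - b - h * b ^+ 2 = h ^+ 2 * (a * b ^+ 2) /\
  a ^+ 2 - b ^+ 2 - h * (2 * b ^+ 3) = h ^+ 2 * (a * b ^+ 2 * (a + 2 * b)).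
Proof.
by move=> tz thz; split; rewrite /a /b; field; rewrite tz thz.
Qed.

(** With [F k] the integral of g(t) / (t - u)^k, one has F_1' = F_2 and F_2' = 2 F_3. The first
    relation is proved at every point off the circle because it must hold near [z]. *)
Lemma derivable2_cauchy g (z : C) : circle_continuous g -> `|z| != 1 ->
  derivable2 (fun u => integral_mu nu (fun t => g t / (t - u))) z.
Proof.
move=> cg z1.
have [M M0 gM] := circle_continuous_bounded 0 (2 * pi) cg.
pose F k := fun u => integral_mu nu (fun t => g t / (t - u) ^+ k).
suff key v : `|v| != 1 ->
    (derivable (F 1%N) v 1 /\ derive1 (F 1%N) v = F 2%N v) /\
    derivable (F 2%N) v 1.
  rewrite (_ : (fun u => _) = F 1%N) //.
  apply: (@derivable2_of_derive1 _ _ (F 2%N)); last exact: (key z z1).2.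
  by apply: filterS (near_norm_neq1 z1) => u u1; exact: (key u u1).1.
(* Half the distance from [v] to the circle: a shift of [v] by less than [d] stays at distance at
   least [d] from the circle, so all inverses below are bounded by [d^-1]. *)
move=> v1; pose d := `|1 - `|v| | / 2.
have d0 : 0 < d by rewrite divr_gt0// normr_gt0 subr_eq0 eq_sym.
have vd (x : R) : 2 * d <= `|expi x - v|.
  rewrite /d mulrC divfK ?pnatr_eq0//; apply: le_trans (ler_dist_dist _ _).
  by rewrite norm_expi.
have vhd (x : R) h : `|h| < d -> d <= `|expi x - (h + v)|.
  move=> hd; rewrite -(lerD2r d) -mulr2n -mulr_natl.
  apply: (le_trans (vd x)).
  rewrite (_ : expi x - v = (expi x - (h + v)) + h); last by ring.
  by apply: (le_trans (ler_normD _ _)); rewrite lerD2l ltW.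
have nz (w : C) : d <= `|w| -> w != 0.
  by move=> dw; rewrite -normr_gt0 (lt_le_trans d0).
have nV (w : C) : d <= `|w| -> `|w^-1| <= d^-1.
  by move=> dw; rewrite normfV lef_pV2// ?posrE ?(lt_le_trans d0).
have d2 x : d <= `|expi x - v|.
  by apply: le_trans (vd x); rewrite mulr_natl mulr2n lerDl ltW.
have h1 h : `|h| < d -> `|h + v| != 1.
  move=> hd; apply/eqP => e; have : 2 * d <= d.
    rewrite {1}/d mulrC divfK ?pnatr_eq0// -e (le_trans (ler_dist_dist _ _))//.
    by rewrite addrK ltW.
  by rewrite ger_pMl// lern1.
have dV0 : 0 <= d^-1 by rewrite invr_ge0 ltW.
split.
(* The remainder is h^2 g a b^2, with a and b the two inverses of [inv_sub_expansion]. *)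
- apply: (@derive1_integral_mu _ _ _ (M * d^-1 ^+ 3) d) => //.
  + by rewrite mulr_ge0// exprn_ge0.
  + by move=> h hd; apply: circle_continuous_cauchy; rewrite ?h1.
  + exact: circle_continuous_cauchy.
  + move=> h x hd xI; set t := expi x.
    have [tv thv] := (d2 x, vhd x h hd).
    have [e _] := @inv_sub_expansion t v h (nz _ tv) (nz _ thv).
    rewrite !expr1 -exprVn mulrCA -!mulrBr e mulrCA mulrC normrM normrX.
    rewrite ler_wpM2r ?exprn_ge0// normrM; apply: ler_pM => //; first exact: gM.
    rewrite [leRHS]exprS normrM normrX ler_pM ?exprn_ge0// ?nV//.
    by rewrite lerXn2r// ?nnegrE// nV.
- suff : derivable (F 2%N) v 1 /\
      derive1 (F 2%N) v =
      integral_mu nu (fun t => 2 * g t / (t - v) ^+ 3) by case.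
  (* Here the remainder is h^2 g a b^2 (a + 2 b); the last factor accounts for the 3. *)
  apply: (@derive1_integral_mu _ _ _ (M * d^-1 ^+ 4 *+ 3) d) => //.
  + by rewrite mulrn_wge0// mulr_ge0// exprn_ge0.
  + by move=> h hd; apply: circle_continuous_cauchy; rewrite ?h1.
  + apply: circle_continuous_cauchy => //.
    exact: circle_continuousM (circle_continuous_cst _) cg.
  + move=> h x hd xI; set t := expi x.
    have [tv thv] := (d2 x, vhd x h hd).
    have [_ e] := @inv_sub_expansion t v h (nz _ tv) (nz _ thv).
    rewrite -!exprVn -[2 * g t * _]mulrA [2 * (g t * _)]mulrCA.
    rewrite [h * (g t * _)]mulrCA -!mulrBr e mulrCA mulrC normrM normrX.
    rewrite ler_wpM2r ?exprn_ge0// -mulrnAr normrM.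
    apply: ler_pM => //; first exact: gM.
    have a3 : `|(t - (h + v))^-1 + 2 * (t - v)^-1| <= d^-1 *+ 3.
      apply: (le_trans (ler_normD _ _)).
      rewrite (_ : d^-1 *+ 3 = d^-1 + 2 * d^-1); last by ring.
      rewrite lerD ?nV// normrM ger0_norm ?ler0n//.
      by rewrite ler_wpM2l ?nV// ler0n.
    rewrite [leRHS](_ : _ = d^-1 ^+ 3 * (d^-1 *+ 3)); last by ring.
    rewrite normrM ler_pM ?mulr_ge0// [leRHS]exprS normrM normrX.
    by rewrite ler_pM ?exprn_ge0// ?nV// lerXn2r// ?nnegrE// nV.
Qed.

End CauchyTransform.

(** * Invertibility of the Riemann-Hilbert matrix *)

(** Subtracting a multiple of the monic [e n] removes the top coefficient. This serves both for the
    orthogonal polynomials and for the monomials. *)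
Lemma poly_span_ind (K : nzRingType) (e : nat -> {poly K}) n
    (P : {poly K} -> Prop) :
  (forall m, e m \is monic) -> (forall m, size (e m) = m.+1) ->
  P 0 -> (forall c p q, P p -> P q -> P (c *: p + q)) ->
  (forall m, (m < n)%N -> P (e m)) ->
  forall p : {poly K}, (size p <= n)%N -> P p.
Proof.
move=> em es P0 PD; elim: n => [_ p|n IHn Pe p pn].
  by rewrite leqn0 size_poly_eq0 => /eqP ->.
rewrite -[p](subrKC (p`_n *: e n)); apply: PD; first exact: Pe.
apply: IHn => [m mn|]; first by apply: Pe; exact: ltnW.
apply/leq_sizeP => j; rewrite leq_eqVlt => /predU1P[<-|nj].
  rewrite coefB coefZ; have /eqP := em n.
  by rewrite /lead_coef es /= => ->; rewrite mulr1 subrr.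
rewrite coefB coefZ (nth_default _ (leq_trans pn nj)).
by rewrite (@nth_default _ 0 (e n) j) ?es// mulr0 subrr.
Qed.

Section Orthogonality.
Context {R : realType}.
Local Notation C := (cplx R).
Variables (nu : C -> R) (Phi : nat -> {poly C}) (kappa : nat -> R).
Hypothesis nu_weight : positive_integrable_weight nu.
Hypothesis Phi_opuc : is_opuc nu Phi kappa.
Implicit Types (p r : {poly C}).

Definition inner_mu p r := integral_mu nu (fun t => p.[t] * (r.[t])^*).

Lemma circle_continuous_inner p r :
  circle_continuous (fun t => p.[t] * (r.[t])^*).
Proof.
apply: circle_continuousM; first exact: circle_continuous_horner.
exact/circle_continuous_conj/circle_continuous_horner.
Qed.

Lemma innerDl a p1 p2 r :
  inner_mu (a *: p1 + p2) r = a * inner_mu p1 r + inner_mu p2 r.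
Proof.
have c1 := circle_continuous_inner p1 r.
have c2 := circle_continuous_inner p2 r.
rewrite -(integral_muZ nu_weight)// -(integral_muD nu_weight)//; last first.
  exact: circle_continuousM (circle_continuous_cst _) c1.
by apply: eq_integral_mu => t _; rewrite !hornerE /=; ring.
Qed.

Lemma innerDr a p r1 r2 :
  inner_mu p (a *: r1 + r2) = a^* * inner_mu p r1 + inner_mu p r2.
Proof.
have c1 := circle_continuous_inner p r1.
have c2 := circle_continuous_inner p r2.
rewrite -(integral_muZ nu_weight)// -(integral_muD nu_weight)//; last first.
  exact: circle_continuousM (circle_continuous_cst _) c1.
apply: eq_integral_mu => t _; rewrite !hornerE rmorphD rmorphM/=; ring.
Qed.

Lemma inner0l r : inner_mu 0 r = 0.
Proof.
have := innerDl (-1) 0 0 r; rewrite scaler0 addr0 mulN1r.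
by rewrite addNr.
Qed.

Lemma inner0r p : inner_mu p 0 = 0.
Proof.
have := innerDr (-1) p 0 0; rewrite scaler0 addr0 rmorphN rmorph1 mulN1r.
by rewrite addNr.
Qed.

Lemma inner_Phi_l n p : (size p <= n)%N -> inner_mu p (Phi n) = 0.
Proof.
have [Phi_monic Phi_size _ Phi_orth] := Phi_opuc; move: p.
apply: (@poly_span_ind _ Phi) => //; first exact: inner0l.
- by move=> a p q p0 q0; rewrite innerDl p0 q0 mulr0 addr0.
- by move=> m mn; rewrite /inner_mu Phi_orth ltn_eqF.
Qed.

Lemma inner_Phi_r n p : (size p <= n)%N -> inner_mu (Phi n) p = 0.
Proof.
have [Phi_monic Phi_size _ Phi_orth] := Phi_opuc; move: p.
apply: (@poly_span_ind _ Phi) => //; first exact: inner0r.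
- by move=> a p q p0 q0; rewrite innerDr p0 q0 mulr0 addr0.
- by move=> m mn; rewrite /inner_mu Phi_orth gtn_eqF.
Qed.

(** If p has degree m and leading coefficient c, then p - c Phi_m has lower degree, so the product
    of p with Phi_m is c kappa_m^(-2). It is nonzero, yet p is orthogonal to every polynomial of
    size at most n, including Phi_m. *)
Lemma inner_nondegenerate n p : (size p <= n)%N ->
  (forall j, (j < n)%N -> inner_mu p 'X^j = 0) -> p = 0.
Proof.
have [Phi_monic Phi_size kappa_gt0 Phi_orth] := Phi_opuc.
move=> pn pX; have p_perp r : (size r <= n)%N -> inner_mu p r = 0.
  move: r; apply: (@poly_span_ind _ (fun j => 'X^j)) => //.
  - by move=> m; exact: monicXn.
  - by move=> m; rewrite size_polyXn.
  - exact: inner0r.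
  - by move=> a r1 r2 r10 r20; rewrite innerDr r10 r20 mulr0 addr0.
apply/eqP; apply: contraT => p0; pose m := (size p).-1.
have sp : size p = m.+1 by rewrite prednK// size_poly_gt0.
have := p_perp (Phi m); rewrite Phi_size -sp pn => /(_ isT).
rewrite -[p](subrKC (lead_coef p *: Phi m)) innerDl [X in _ + X]inner_Phi_l.
  rewrite addr0 /inner_mu Phi_orth eqxx => /eqP; rewrite mulf_eq0 lead_coef_eq0.
  rewrite (negPf p0)/= fmorph_eq0 invr_eq0 expf_eq0/= => /eqP k0.
  by have := kappa_gt0 m; rewrite k0 ltxx.
apply/leq_sizeP => j; rewrite leq_eqVlt => /predU1P[<-|mj].
  rewrite coefB coefZ; have /eqP := Phi_monic m.
  by rewrite /lead_coef Phi_size /= => ->; rewrite mulr1 subrr.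
by rewrite coefB coefZ !nth_default ?mulr0 ?subrr ?Phi_size ?sp.
Qed.

(** * Reversed polynomials and second-kind functions *)

(** The genuine polynomial behind [reversed]. At the origin it takes the value 1, whereas [reversed]
    gives 0 there when n > 0. *)
Definition reversed_poly n : {poly C} := \poly_(k < n.+1) ((Phi n)`_(n - k))^*.

Lemma reversedE n z : z != 0 -> reversed Phi n z = (reversed_poly n).[z].
Proof.
have [_ Phi_size _ _] := Phi_opuc => z0.
rewrite /reversed horner_coef Phi_size horner_poly rmorph_sum mulr_sumr.
rewrite (reindex_inj rev_ord_inj); apply: eq_bigr => i _ /=.
rewrite rmorphM rmorphXn fmorphV/= conjCK subSS mulrCA; congr (_ * _).
by rewrite exprVn -expfB_cond ?(negPf z0) ?leq_subr//; rewrite subKn// -ltnS.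
Qed.

Lemma circle_invC (t : C) : `|t| = 1 -> t^-1 = t^*.
Proof. by move=> t1; rewrite invC_norm t1 expr1n invr1 mul1r. Qed.

Lemma circle_neq0 (t : C) : `|t| = 1 -> t != 0.
Proof. by move=> t1; rewrite -normr_eq0 t1 oner_eq0. Qed.

(** Conjugation inverts t on the circle, so the integrand becomes t^(n-j) times the conjugate of
    Phi_n(t). The condition j > 0 makes the degree n - j smaller than n. *)
Lemma inner_reversed_X n j : (0 < j <= n)%N ->
  inner_mu (reversed_poly n) 'X^j = 0.
Proof.
move=> /andP[j0 jn]; rewrite -(@inner_Phi_l n 'X^(n - j)); last first.
  by rewrite size_polyXn ltn_subrL j0 (leq_trans j0).
apply: eq_integral_mu => t t1; have t0 := circle_neq0 t1.
rewrite -reversedE// /reversed -(circle_invC t1) invrK !hornerXn.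
rewrite rmorphXn/= -(circle_invC t1) mulrAC; congr (_ * _).
by rewrite exprVn expfB_cond ?(negPf t0).
Qed.

Lemma eq_circle_integral (f g : C -> C) : (forall t, `|t| = 1 -> f t = g t) ->
  circle_integral f = circle_integral g.
Proof.
move=> fg; rewrite /circle_integral; congr integral_angle.
by apply/funext => x; rewrite fg// norm_expi.
Qed.

(* The factor ['i * t] turns [dmu] into [nu(t) dt]. *)
Definition cauchy_integral n p z :=
  integral_mu nu (fun t => p.[t] * ('i * t / t ^+ n) / (t - z)).

Lemma circle_continuous_cauchy_density n p :
  circle_continuous (fun t => p.[t] * ('i * t / t ^+ n)).
Proof.
apply: circle_continuousM; first exact: circle_continuous_horner.
apply: circle_continuousM.
  exact: circle_continuousM (circle_continuous_cst _) circle_continuous_id.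
apply: circle_continuousV; first exact: circle_continuousX circle_continuous_id.
by move=> x; rewrite expf_neq0// expi_neq0.
Qed.

Lemma second_kindE n z :
  second_kind nu Phi n z = (2 * ofR pi * 'i)^-1 * cauchy_integral n (Phi n) z.
Proof.
congr (_ * _); apply: eq_circle_integral => t t1.
have t0 := circle_neq0 t1; have i0 : 'i != 0 :> C by exact: neq0Ci.
(* Abstracting the inverses avoids the side condition t != z, so the formula holds for every [z] and
   can be used as an equality of functions. *)
by move: (t - z)^-1 (t ^+ n)^-1 => w y; field; rewrite i0 t0.
Qed.

Lemma second_kind_revE n z : second_kind_rev nu Phi n z =
  (2 * ofR pi * 'i)^-1 * cauchy_integral n (reversed_poly n.-1) z.
Proof.
congr (_ * _); apply: eq_circle_integral => t t1.
have t0 := circle_neq0 t1; have i0 : 'i != 0 :> C by exact: neq0Ci.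
rewrite reversedE//.
by move: (t - z)^-1 (t ^+ n)^-1 => w y; field; rewrite i0 t0.
Qed.

Lemma cauchy_integralD n a1 a2 p1 p2 z : `|z| != 1 ->
  cauchy_integral n (a1 *: p1 + a2 *: p2) z =
  a1 * cauchy_integral n p1 z + a2 * cauchy_integral n p2 z.
Proof.
move=> z1.
have cz p : circle_continuous (fun t => p.[t] * ('i * t / t ^+ n) / (t - z)).
  under eq_fun do rewrite -[_ - z]expr1.
  exact: circle_continuous_cauchy (circle_continuous_cauchy_density _ _) _.
have caz a p : circle_continuous
    (fun t => a * (p.[t] * ('i * t / t ^+ n) / (t - z))).
  exact: circle_continuousM (circle_continuous_cst _) (cz _).
rewrite -!(integral_muZ nu_weight)// -(integral_muD nu_weight)//.
apply: eq_integral_mu => t _; rewrite hornerD !hornerZ.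
by move: (t - z)^-1 (t ^+ n)^-1 => w y; ring.
Qed.

Lemma cauchy_root_eq0 n p z : (0 < n)%N -> (size p <= n.+1)%N -> `|z| != 1 ->
  (forall j, (0 < j < n)%N -> inner_mu p 'X^j = 0) ->
  p.[z] = 0 -> cauchy_integral n p z = 0 -> p = 0.
Proof.
move=> n0 pn z1 pX pz cz.
have /factor_theorem[r pE] : root p z by apply/rootP.
have tzV t : `|t| = 1 -> t - z != 0.
  by move=> t1; rewrite subr_eq0; apply: contra_neq z1 => <-.
have crX a j : circle_continuous (fun t => a * (r.[t] * ('X^j).[t]^*)).
  exact: circle_continuousM (circle_continuous_cst _)
    (circle_continuous_inner _ _).
(* On the circle, t times the conjugate of t^(j+1) is the conjugate of t^j. When the left side
   vanishes, orthogonality of [r] passes from exponent j + 1 down to j. *)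
have rec j : inner_mu p 'X^(j.+1) = inner_mu r 'X^j - z * inner_mu r 'X^(j.+1).
  rewrite -[inner_mu r 'X^j]mul1r -mulNr.
  rewrite -!(integral_muZ nu_weight); try exact: circle_continuous_inner.
  rewrite -(integral_muD nu_weight)//; apply: eq_integral_mu => t t1.
  rewrite pE !hornerE !rmorphXn/= exprS -(circle_invC t1).
  by field; rewrite circle_neq0.
(* The kernel cancels the factor t - z of [p], and i t / t^n is i times the conjugate of t^(n-1). *)
have top : inner_mu r 'X^(n.-1) = 0.
  apply/eqP; rewrite -(mulrI_eq0 _ (lregP (neq0Ci C))) -cz.
  rewrite -(integral_muZ nu_weight); last exact: circle_continuous_inner.
  apply/eqP/eq_integral_mu => t t1.
  rewrite pE !hornerE !rmorphXn/= -(circle_invC t1) -[in RHS](prednK n0) exprS.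
  have := expf_neq0 n.-1 (circle_neq0 t1); have := circle_neq0 t1.
  have := tzV t t1; rewrite exprVn; move: (t ^+ n.-1) => x tz t0 x0.
  move: 'i => i.
  by field; rewrite x0 t0 tz.
(* The descent from n - 1 to 0, indexed by the number of steps, uses [pX] at the exponents n - 1,
   ..., 1, which are exactly those available. *)
have rX k : (k < n)%N -> inner_mu r 'X^(n.-1 - k) = 0.
  elim: k => [|k IHk] kn; first by rewrite subn0.
  have [jn jE] : (0 < (n.-1 - k.+1).+1 < n)%N /\
      (n.-1 - k.+1).+1 = (n.-1 - k)%N.
    by clear -kn; lia.
  have e := rec (n.-1 - k.+1)%N.
  by rewrite (pX _ jn) jE (IHk (ltnW kn)) mulr0 subr0 in e; exact: esym e.
have [r0|r0] := eqVneq r 0; first by rewrite pE r0 mul0r.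
suff r0' : r = 0 by rewrite r0' eqxx in r0.
apply: (@inner_nondegenerate n).
  by move: pn; rewrite pE size_Mmonic ?monicXsubC// size_XsubC addn2.
move=> j jn; rewrite -(rX (n.-1 - j)%N); [congr (inner_mu _ 'X^_)|];
  by clear -jn; lia.
Qed.

Lemma det_Ymx_neq0 n z : (0 < n)%N -> `|z| != 1 -> z != 0 ->
  \det (Ymx nu Phi kappa n z) != 0.
Proof.
have [Phi_monic Phi_size kappa_gt0 _] := Phi_opuc => n0 z1 z0.
have Phi_lead m : (Phi m)`_m = 1.
  by have /eqP := Phi_monic m; rewrite /lead_coef Phi_size.
apply/det0P => -[v v0 vY].
(* [b] absorbs the normalization of the second row, so that the two columns of [vY] speak of one
   polynomial [p]: its value at [z] and its Cauchy integral. *)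
pose a := v 0 0; pose b := - b_coef kappa n.-1 * v 0 1.
have vYE j :
    a * Ymx nu Phi kappa n z 0 j + v 0 1 * Ymx nu Phi kappa n z 1 j = 0.
  have : (v *m Ymx nu Phi kappa n z) 0 j = 0 by rewrite vY mxE.
  rewrite mxE big_ord_recl big_ord1.
  by rewrite (_ : lift ord0 ord0 = (1 : 'I_2)) //; exact: val_inj.
have s_rev : (size (reversed_poly n.-1) <= n)%N.
  by rewrite -[leqRHS](prednK n0) size_poly.
pose p := a *: Phi n + b *: reversed_poly n.-1.
have p0 : p = 0.
  apply: (@cauchy_root_eq0 n p z) => //.
  - rewrite (leq_trans (size_polyD _ _))// geq_max.
    rewrite (leq_trans (size_scale_leq _ _)) ?Phi_size//.
    by rewrite (leq_trans (size_scale_leq _ _))// ltnW// ltnS.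
  - move=> j /andP[j0 jn].
    rewrite innerDl inner_Phi_r ?size_polyXn// mulr0 add0r.
    rewrite -[_ *: _]addr0 innerDl inner0l addr0 inner_reversed_X ?mulr0//.
    by rewrite j0 -ltnS prednK.
  - rewrite !hornerE -reversedE// -(vYE 0) !mxE /=.
    by rewrite /b; ring.
  - rewrite cauchy_integralD//.
    have := vYE 1; rewrite !mxE/= second_kindE second_kind_revE => e.
    have c0 : (2 * ofR pi * 'i)^-1 != 0 :> C.
      rewrite invr_eq0 !mulf_neq0 ?neq0Ci ?pnatr_eq0//.
      by rewrite fmorph_eq0 gt_eqF// pi_gt0.
    by apply: (mulfI c0); rewrite mulr0 -e /b; ring.
(* In degree n only the monic [Phi n] contributes, the reversed polynomial having degree below n. *)
have a0 : a = 0.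
  have : p`_n = 0 by rewrite p0 coef0.
  rewrite coefD !coefZ Phi_lead mulr1 (@nth_default _ _ (reversed_poly _))//.
  by rewrite mulr0 addr0.
(* The constant term of the reversed polynomial is the conjugate of a leading coefficient, hence
   1. *)
have b0 : b = 0.
  have : p`_0 = 0 by rewrite p0 coef0.
  rewrite coefD !coefZ a0 mul0r add0r coef_poly /= subn0 Phi_lead.
  by rewrite rmorph1 mulr1.
move/eqP : v0; apply; apply/rowP => j; rewrite mxE.
have v1 : v 0 1 = 0.
  have bc : b_coef kappa n.-1 != 0.
    by rewrite fmorph_eq0 gt_eqF// !mulr_gt0 ?pi_gt0 ?exprn_gt0.
  by move/eqP : b0; rewrite mulf_eq0 oppr_eq0 (negPf bc)/= => /eqP.
case: j => -[|[|//]] jlt; [rewrite -[RHS]a0|rewrite -[RHS]v1];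
  by congr (v 0 _); exact/val_inj.
Qed.

End Orthogonality.

(** * Local branches and the structure matrix *)

Lemma near_neq0 (K : numFieldType) (z : K) :
  z != 0 -> \forall u \near z, u != 0.
Proof.
by move=> z0; apply: (@derivable_neq0 K id z) => //; exact: derivable_id.
Qed.

(** To be used with [a], [b], [c] equal to Y'', Y' D' and Y D''. *)
Lemma mulmx_cancel_right (K : comUnitRingType) n (D a b c N Y : 'M[K]_n) :
  D \in unitmx -> a *m D + 2 *: b + c = N *m (Y *m D) ->
  a + 2 *: (b *m invmx D) + c *m invmx D = N *m Y.
Proof.
move=> Du e; rewrite -[N *m Y](mulmxK Du) -[_ *m D]mulmxA -e !mulmxDl.
by rewrite -scalemxAl mulmxK.
Qed.

Section Branches.
Context {R : realType}.
Local Notation C := (cplx R).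
Implicit Types (nu : C -> R) (A : {poly C}) (q w s : C -> C) (c e z : C).

Lemma derivable2_mx22 (f g h k : C -> C) z :
  derivable2 f z -> derivable2 g z -> derivable2 h z -> derivable2 k z ->
  derivable2 (fun u => mx22 (f u) (g u) (h u) (k u)) z.
Proof.
move=> df dg dh dk; apply: derivable2_matrix => i j.
rewrite (_ : (fun u => _) = if i == 0 then (if j == 0 then f else g)
                            else (if j == 0 then h else k)).
  by case: ifP => _; case: ifP => _; [exact: df|exact: dg|exact: dh|exact: dk].
by apply/funext => u; rewrite mxE; case: ifP => _; case: ifP => _.
Qed.

(** Both constructors record the differential equation on their own disk, so no induction along the
    chain of continuations arises. *)
Lemma weight_element_function nu A q c e w :
  weight_element nu A q c e w -> function_element A q c e w.
Proof. by case. Qed.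

Lemma derivable2_Ymx nu (Phi : nat -> {poly C}) (kappa : nat -> R) n z :
  positive_integrable_weight nu -> is_opuc nu Phi kappa -> `|z| != 1 ->
  z != 0 -> derivable2 (Ymx nu Phi kappa n) z.
Proof.
move=> nu_weight Phi_opuc z1 z0.
have dcauchy p : derivable2 (cauchy_integral nu n p) z.
  apply: derivable2_cauchy => //; exact: circle_continuous_cauchy_density.
apply: derivable2_mx22.
- exact: derivable2_horner.
- rewrite (funext (second_kindE nu Phi n)).
  by apply: derivable2M; [exact: derivable2_cst|exact: dcauchy].
- apply: derivable2M; first exact: derivable2_cst.
  apply: derivable2_near_eq;
    last exact: (derivable2_horner (reversed_poly Phi n.-1)).
  near=> u; rewrite (reversedE Phi_opuc)//; near: u.
  exact: near_neq0.
- apply: derivable2M; first exact: derivable2_cst.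
  rewrite (funext (second_kind_revE Phi_opuc n)).
  by apply: derivable2M; [exact: derivable2_cst|exact: dcauchy].
Unshelve. all: by end_near. Qed.

Lemma near_ball_center c e z : 0 < e -> ball c e z ->
  \forall u \near z, ball c e u.
Proof.
by move=> e0 cz; apply: open_nbhs_nbhs; split => //; exact: ball_open.
Qed.

(** The logarithmic derivatives 1/u of the identity and q/(uA) of the weight are derivable on the
    disk, which avoids the zeros of zA. By [derivable2_sqrt] the branches [r] and [s] are then twice
    derivable. *)
Lemma C_branch_derivable2 nu A q n z D : entire q -> C_branch nu A q n z D ->
  derivable2 D z /\ D z \in unitmx.
Proof.
move=> q_entire [c [e [w [r [s [wel cz r_sqrt s_sqrt DE]]]]]].
have [e0 zeros w_sol] := weight_element_function wel.
have ball_near := near_ball_center e0 cz.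
have zA_neq0 u : ball c e u -> u * A.[u] != 0.
  move=> cu; apply/negP => /eqP uA.
  suff : (ball c e `&` zeros_zA A) u by rewrite zeros.
  by split=> //; rewrite /zeros_zA /= rootE !hornerE uA.
have r0 : r z != 0.
  have [_ rz] := r_sqrt z cz; apply: contraNneq (zA_neq0 z cz) => rz0.
  by rewrite -[z in z * _]rz rz0 expr0n mul0r.
have s0 : s z != 0.
  have [_ w0 _] := w_sol z cz; have [_ sz] := s_sqrt z cz.
  by apply: contraNneq w0 => sz0; rewrite -sz sz0 expr0n.
have dr : derivable2 r z.
  apply: (@derivable2_sqrt _ r id (fun u => u^-1)).
  - by apply: filterS ball_near => u; exact: r_sqrt.
  - apply: filterS ball_near => u /zA_neq0; rewrite mulf_eq0 negb_or.
    by move=> /andP[u0 _]; split=> //; rewrite derive1E derive_id mulVf.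
  - apply: derivable2_derivable; apply: (derivable2V (derivable2_id z)).
    by have := zA_neq0 z cz; rewrite mulf_eq0 negb_or => /andP[].
have ds : derivable2 s z.
  apply: (@derivable2_sqrt _ s w (fun u => q u * (u * A.[u])^-1)).
  - by apply: filterS ball_near => u; exact: s_sqrt.
  - apply: filterS ball_near => u cu; have [_ w0 wE] := w_sol u cu.
    split=> //; apply: (mulfI (zA_neq0 u cu)).
    by rewrite wE mulrCA -mulrA mulKf// zA_neq0.
  - apply: derivableM; first exact: q_entire.
    apply: derivableV; first exact: zA_neq0.
    apply: derivableM; first exact: derivable_id.
    exact/derivable2_derivable/derivable2_horner.
have near_D : {near z,
    (fun u => mx22 (r u ^- n * s u) 0 0 (r u ^+ n * (s u)^-1)) =1 D}.
  by apply: filterS ball_near => u cu; rewrite DE.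
split; last first.
  rewrite unitmxE unitfE DE// det_trig => [|]; last first.
    apply/is_trig_mxP => -[[|[|//]] ilt] [[|[|//]] jlt] //= _.
    by rewrite mxE.
  rewrite big_ord_recl big_ord1 !mxE /=.
  by rewrite !mulf_neq0 ?invr_eq0 ?expf_neq0.
have rn0 : r z ^+ n != 0 by exact: expf_neq0.
have drn := derivable2X n dr.
have D11 := derivable2M (derivable2V drn rn0) ds.
have D22 := derivable2M drn (derivable2V ds s0).
have D0 := derivable2_cst 0 z.
apply: derivable2_near_eq near_D _.
exact: (derivable2_mx22 D11 D0 D0 D22).
Qed.

End Branches.

Theorem proposition3p7 (R : realType)
    (nu : cplx R -> R) (A : {poly cplx R}) (q : cplx R -> cplx R)
    (Phi : nat -> {poly cplx R}) (kappa : nat -> R)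
    (nu_weight : positive_integrable_weight nu)
    (nu_semiclassical : generalized_semiclassical nu A q)
    (Phi_opuc : is_opuc nu Phi kappa)
    (n : nat) (n_gt0 : (0 < n)%N)
    (z : cplx R) (z_circle : ~ unit_circle z) (z_zeros : ~ zeros_zA A z)
    (D : cplx R -> 'M[cplx R]_2) (D_branch : C_branch nu A q n z D) :
  let Y := Ymx nu Phi kappa n in
  let M := structure_mx Y D in
  derive1 (derive1 Y) z + 2 *: (derive1 Y z *m derive1 D z *m invmx (D z))
    + Y z *m derive1 (derive1 D) z *m invmx (D z)
  = (derive1 M z + M z *m M z) *m Y z.
Proof.
move=> Y M; have [_ q_entire _] := nu_semiclassical.
have z1 : `|z| != 1 by apply/eqP.
(* The origin is always a zero of zA. *)
have z0 : z != 0.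
  by apply: contra_notN z_zeros => /eqP ->; rewrite /zeros_zA /= rootE !hornerE.
have [dD Dz] := C_branch_derivable2 q_entire D_branch.
have dY : derivable2 Y z by exact: derivable2_Ymx.
have Yz : Y z \in unitmx.
  by rewrite unitmxE unitfE; exact: (det_Ymx_neq0 nu_weight Phi_opuc).
have Zz : Y z *m D z \in unitmx by rewrite unitmx_mul Yz Dz.
(* Z'' is evaluated twice: here through the structure matrix, then by the Leibniz rule. *)
have ZE : derive1 (derive1 (fun u => Y u *m D u)) z =
    (derive1 M z + M z *m M z) *m (Y z *m D z).
  exact: (derive1_log_derivative (derivable2_mulmx dY dD) Zz).
rewrite (derive12_mulmx dY dD) in ZE.
exact: (mulmx_cancel_right Dz ZE).
Qed.
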